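(* The global proof size for the language At-most-one-selected (AMOS) is in $O(\log n)$. That is, there exists a purely global nondeterministic scheme for AMOS whose global certificate on $n$-node instances of the language has $O(\log n)$ bits.
   Context: A network is a finite connected simple graph without loops; $n$ is its number of nodes. Nodes carry pairwise distinct identifiers, which are positive integers in a range polynomial in $n$ (at most $n^{\kappa}$ for a fixed constant $\kappa\ge 1$), so each identifier has $O(\log n)$ bits. Nodes and edges may carry inputs. A distributed language is a set of graphs with inputs (membership does not depend on identifiers). A purely global nondeterministic scheme for a language $\mathcal L$ consists of a verifier of constant radius $r$: each node $v$ sees its $r$-neighborhood (the structure of the graph, the identifiers and the inputs of the nodes at distance at most $r$ from $v$), together with one single certificate string that is seen by all nodes, and outputs accept or reject. The verifier is uniform (it does not know $n$). The scheme is correct if for every labeled graph: there exists a certificate making every node accept if and only if the labeled graph is in $\mathcal L$. The global proof size $s_g(n)$ is the number of bits of the certificate used on $n$-node graphs of $\mathcal L$. AMOS: each node has a binary input; a node is selected if its input is 1; a labeled graph is in AMOS if and only if at most one node is selected. *)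

(* Defs.v *)
(* MathComp and MathComp-Analysis. *)
From HB Require Import structures.
From mathcomp Require Import all_boot all_order all_algebra.
From mathcomp Require Import all_classical all_reals all_analysis.

Set Implicit Arguments.
Unset Strict Implicit.
Unset Printing Implicit Defensive.

Import Order.TTheory GRing.Theory Num.Theory.
Import numFieldNormedType.Exports.

Local Open Scope ring_scope.

(* [I] and [J] are the types of the node and edge inputs.  Only the values of
   [edge_input] on adjacent pairs are meaningful. *)
Record labeled_graph (I J : Type) := LabeledGraph {
  node :> finType;
  adj : rel node;
  node_input : node -> I;
  edge_input : node -> node -> J;
  node_nonempty : (0 < #|node|)%N;
  adj_sym : symmetric adj;
  adj_irr : irreflexive adj;
  adj_connected : forall u v, connect adj u v;
  edge_input_sym : forall u v, edge_input u v = edge_input v u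
}.

Definition language (I J : Type) := labeled_graph I J -> Prop.

Definition valid_ids (R : realType) (kappa : R) (I J : Type)
    (G : labeled_graph I J) (id : G -> nat) : Prop :=
  injective id /\
  forall v, (0 < id v)%N /\ (id v)%:R <= #|G|%:R `^ kappa.

Definition ball (I J : Type) (G : labeled_graph I J) (r : nat) (v : G) :
    {set G} :=
  [set u | [exists p : r.-bseq G, path (@adj _ _ G) v p && (last v p == u)]]%SET.

(* What a node sees.  Since identifiers are distinct, a rooted neighborhood
   with identifiers is determined up to isomorphism by the data below, in which
   nodes are named by their identifiers: [view_node i] is the input of the
   visible node with identifier [i], and [view_edge i j] the input of the edge
   between the visible nodes with identifiers [i] and [j]; both are [None] when
   there is no such node or edge. *)
Record view (I J : Type) := View {
  view_root : nat;
  view_node : nat -> option I;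
  view_edge : nat -> nat -> option J
}.

Section LocalView.
Variables (I J : Type) (G : labeled_graph I J) (id : G -> nat).
Variables (r : nat) (v : G).

Definition visible (i : nat) : option G := [pick u in ball r v | id u == i].

Definition local_view : view I J := {|
  view_root := id v;
  view_node := fun i => omap (@node_input _ _ G) (visible i);
  view_edge := fun i j =>
    if (visible i, visible j) is (Some u, Some w) then
      if adj u w then Some (edge_input u w) else None
    else None
|}.

End LocalView.

Definition certificate := seq bool.

Record global_scheme (I J : Type) := GlobalScheme {
  radius : nat;
  verifier : view I J -> certificate -> bool
}.

Definition all_accept (I J : Type) (S : global_scheme I J)
    (G : labeled_graph I J) (id : G -> nat) (c : certificate) : Prop :=
  forall v : G, verifier S (local_view id (radius S) v) c.

Definition correct (R : realType) (kappa : R) (I J : Type)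
    (L : language I J) (S : global_scheme I J) : Prop :=
  forall (G : labeled_graph I J) (id : G -> nat), valid_ids kappa id ->
    (exists c, all_accept S id c) <-> L G.

(* Only instances of the language are charged; soundness, part of [correct], is
   against certificates of arbitrary length. *)
Definition certificate_size_le (R : realType) (kappa : R) (I J : Type)
    (L : language I J) (S : global_scheme I J) (s : nat -> nat) : Prop :=
  forall (G : labeled_graph I J) (id : G -> nat), valid_ids kappa id -> L G ->
    exists c, all_accept S id c /\ (size c <= s #|G|)%N.

(* Edges carry no input. *)
Definition AMOS : language bool unit :=
  fun G => (#|[set v : G | node_input v]%SET| <= 1)%N.

(* Main.v *)
Require Import Defs.
From HB Require Import structures.
From mathcomp Require Import all_boot all_order all_algebra.
From mathcomp Require Import all_classical all_reals all_analysis.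
Import Order.TTheory GRing.Theory Num.Theory.
Import numFieldNormedType.Exports.
Local Open Scope classical_set_scope.
Local Open Scope ring_scope.

(** The certificate is the identifier of the selected node in binary, and each
    selected node checks that the certificate denotes its own identifier:
    as identifiers are distinct, at most one selected node can accept. *)

Definition nat_of_bits (c : seq bool) : nat :=
  foldr (fun (b : bool) m => (b + m.*2)%N) 0%N c.

(** The head of the list is the low bit, so induction on [k] peels off [odd m] and recurses on
    [m./2]. Zeros at the high end pad the string to length exactly [k]. *)
Lemma nat_of_bits_surj (k m : nat) :
  (m < 2 ^ k)%N -> exists2 c, size c = k & nat_of_bits c = m.
Proof.
elim: k m => [|k IHk] m.
  by rewrite expn0 ltnS leqn0 => /eqP->; exists [::].
rewrite expnS mul2n => lt_m.
have [c sz_c c_m] : exists2 c, size c = k & nat_of_bits c = m./2.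
  by apply: IHk; rewrite ltn_half_double.
by exists (odd m :: c); rewrite /= ?sz_c ?c_m ?odd_double_half.
Qed.

(** Radius 0 suffices: a node compares the certificate with its own identifier only, and reads its
    own input by looking up that identifier in its view. Unselected nodes accept every
    certificate. *)
Definition amos_scheme : global_scheme bool unit :=
  GlobalScheme 0 (fun w c =>
    (view_node w (view_root w) == Some true)
      ==> (nat_of_bits c == view_root w)).

Lemma ball_refl (I J : Type) (G : labeled_graph I J) (r : nat) (v : G) :
  v \in Defs.ball r v.
Proof.
by rewrite inE; apply/existsP; exists (Bseq (leq0n r : (size [::] <= r)%N)) => /=.
Qed.

Lemma visible_self (I J : Type) (G : labeled_graph I J) (id : G -> nat)
    (r : nat) (v : G) : injective id -> visible id r v (id v) = Some v.
Proof.
move=> id_inj; rewrite /visible; case: pickP => [u /andP[_ /eqP/id_inj->]//|].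
by move/(_ v); rewrite ball_refl eqxx.
Qed.

Lemma amos_all_accept (G : labeled_graph bool unit) (id : G -> nat)
    (c : certificate) : injective id ->
  all_accept amos_scheme id c <->
  (forall v : G, node_input v -> nat_of_bits c = id v).
Proof.
move=> id_inj; split=> acc v.
  by move=> sel_v; move: (acc v); rewrite /= visible_self //= sel_v => /eqP.
rewrite /= visible_self //=; apply/implyP => /eqP[sel_v].
by apply/eqP; exact: acc.
Qed.

Lemma amos_sound (G : labeled_graph bool unit) (id : G -> nat)
    (c : certificate) : injective id -> all_accept amos_scheme id c -> AMOS G.
Proof.
move=> id_inj /(amos_all_accept _ _ _ id_inj) acc.
apply/card_le1_eqP => u v; rewrite !inE => sel_u sel_v.
by apply: id_inj; rewrite -(acc u) // -(acc v).
Qed.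

(** Binary length of the integer part of [n ^ kappa], the largest value that an identifier may
    take. *)
Definition max_id_bits {R : realType} (kappa : R) (n : nat) : nat :=
  (trunc_log 2 (Num.truncn (n%:R `^ kappa))).+1.

Lemma amos_complete (R : realType) (kappa : R) (G : labeled_graph bool unit)
    (id : G -> nat) : valid_ids kappa id -> AMOS G ->
  exists c, all_accept amos_scheme id c /\ (size c <= max_id_bits kappa #|G|)%N.
Proof.
move=> [id_inj id_le] /card_le1_eqP le1.
case: (pickP (fun v : G => node_input v)) => [v sel_v|none]; last first.
  (* With no selected node, every certificate is accepted; the empty one is taken. *)
  by exists [::]; split=> //; apply/amos_all_accept => // v; rewrite none.
have [c sz_c c_v] : exists2 c, size c = max_id_bits kappa #|G|
    & nat_of_bits c = id v.
  apply: nat_of_bits_surj; apply: leq_ltn_trans (trunc_log_ltn _ (ltnSn 1)).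
  by rewrite truncn_ge_nat ?powR_ge0 //; case: (id_le v).
exists c; split; last by rewrite sz_c.
apply/amos_all_accept => // u sel_u.
by rewrite c_v; congr id; apply: le1; rewrite inE.
Qed.

(** With [t] the truncated logarithm, [2 ^ t <= Num.truncn x <= x]; take logarithms. The first
    inequality needs [Num.truncn x] positive, hence [1 <= x]. *)
Lemma trunc_log2_le (R : realType) (x : R) :
  1 <= x -> (trunc_log 2 (Num.truncn x))%:R * ln 2 <= ln x.
Proof.
move=> x_ge1; have x_gt0 : 0 < x by exact: lt_le_trans x_ge1.
have t_gt0 : (0 < Num.truncn x)%N by rewrite truncn_gt0.
rewrite mulr_natl -lnXn //.
rewrite ler_ln ?posrE ?exprn_gt0 //.
have/(le_trans _)-> // : (Num.truncn x)%:R <= x by rewrite truncn_le ltW.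
by rewrite -natrX ler_nat trunc_logP.
Qed.

Lemma max_id_bits_bigO (R : realType) (kappa : R) : 0 <= kappa ->
  (fun n : nat => (max_id_bits kappa n)%:R : R)
    =O_\oo (fun n : nat => ln (n%:R : R)).
Proof.
move=> kappa_ge0; apply/eqO_exP.
have ln2_gt0 : 0 < ln 2 :> R by rewrite ln_gt0 // ltr1n.
(* The share [kappa] pays for the base-2 logarithm of [n ^ kappa], the share [1] for the extra bit,
   since [ln 2 <= ln n] once [n >= 2]. *)
exists ((kappa + 1) / ln 2); first by rewrite divr_gt0 // ltr_wpDl.
exists 2%N => // n /= n_ge2.
have n_gt0 : 0 < n%:R :> R by rewrite ltr0n (leq_trans _ n_ge2).
have ln2_le : ln 2 <= ln n%:R :> R by rewrite ler_ln ?posrE // ler_nat.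
rewrite ger0_norm ?ler0n // ger0_norm; last exact: le_trans (ltW ln2_gt0) _.
rewrite mulrAC ler_pdivlMr // /max_id_bits -natr1 !mulrDl !mul1r lerD //.
(* The remaining bound is the previous lemma at [x = n ^ kappa], which is at least [n ^ 0 = 1]. *)
rewrite -[leRHS]ln_powR; apply: trunc_log2_le.
rewrite -[leLHS](powRr0 n%:R) ler_powR //.
by rewrite ler1n (leq_trans _ n_ge2).
Qed.

Theorem theorem2 (R : realType) (kappa : R) (kappa_ge1 : 1 <= kappa) :
  exists (S : global_scheme bool unit) (s : nat -> nat),
    [/\ correct kappa AMOS S,
        certificate_size_le kappa AMOS S s
      & (fun n : nat => (s n)%:R : R) =O_\oo (fun n : nat => ln (n%:R : R))].
Proof.
exists amos_scheme, (max_id_bits kappa); split.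
- move=> G id ids; split=> [[c]|amos].
    by apply: amos_sound; case: ids.
  by have [c [acc _]] := amos_complete _ _ _ _ ids amos; exists c.
- by move=> G id; exact: amos_complete.
- by apply: max_id_bits_bigO; exact: le_trans kappa_ge1.
Qed.
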